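(* Any coherent category is algebraically coherent.
   Context: A cospan $(f\colon X\to Z,\ g\colon Y\to Z)$ in a category with finite limits is jointly strongly epimorphic if every monomorphism into $Z$ through which both $f$ and $g$ factor is an isomorphism. A functor between categories with finite limits is coherent if it preserves finite limits and jointly strongly epimorphic pairs. A regular category $\mathcal{C}$ with finite coproducts is a coherent category if for every morphism $f\colon X\to Y$ in $\mathcal{C}$ the change-of-base (pullback) functor $f^*\colon(\mathcal{C}\downarrow Y)\to(\mathcal{C}\downarrow X)$ between slice categories is coherent. $\mathsf{Pt}_X(\mathcal{C})$ is the category of points over $X$: objects are triples $(A,\ p\colon A\to X,\ s\colon X\to A)$ with $ps=1_X$, and morphisms are morphisms between the objects $A$ commuting with the $p$'s and the $s$'s. For $f\colon X\to Y$, the change-of-base functor $f^*\colon \mathsf{Pt}_Y(\mathcal{C})\to\mathsf{Pt}_X(\mathcal{C})$ is pulling back along $f$. A category $\mathcal{C}$ with finite limits is algebraically coherent if $f^*\colon \mathsf{Pt}_Y(\mathcal{C})\to\mathsf{Pt}_X(\mathcal{C})$ is coherent for every morphism $f\colon X\to Y$ of $\mathcal{C}$. *)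

(* Defs.v *)
From Stdlib Require Import List FinFun ClassicalEpsilon ProofIrrelevance.

Set Implicit Arguments.
Unset Strict Implicit.
Unset Printing Implicit Defensive.

(** * Categories and functors *)

Record Category : Type := mkCategory {
  Ob :> Type;
  Hom : Ob -> Ob -> Type;
  idm : forall A, Hom A A;
  comp : forall A B D, Hom B D -> Hom A B -> Hom A D;
  comp_idl : forall A B (f : Hom A B), comp (idm B) f = f;
  comp_idr : forall A B (f : Hom A B), comp f (idm A) = f;
  comp_assoc : forall A B D E (h : Hom D E) (g : Hom B D) (f : Hom A B),
    comp h (comp g f) = comp (comp h g) f
}.

Arguments Hom {c} _ _.
Arguments idm {c} _.
Arguments comp {c A B D} _ _.

Declare Scope cat_scope.
Delimit Scope cat_scope with cat.
Open Scope cat_scope.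
Notation "g ∘ f" := (comp g f) (at level 40, left associativity) : cat_scope.

Record Functor (C D : Category) : Type := mkFunctor {
  fob :> C -> D;
  fmap : forall A B : C, Hom A B -> Hom (fob A) (fob B);
  fmap_id : forall A : C, fmap (idm A) = idm (fob A);
  fmap_comp : forall (A B E : C) (g : Hom B E) (f : Hom A B),
    fmap (g ∘ f) = fmap g ∘ fmap f
}.

Arguments fmap {C D} _ {A B} _.

Definition functor_comp (B C D : Category) (G : Functor C D) (F : Functor B C) :
  Functor B D.
Proof.
refine (@mkFunctor B D (fun A => G (F A)) (fun A A' u => fmap G (fmap F u)) _ _).
- intros A; now rewrite !fmap_id.
- intros; now rewrite !fmap_comp.
Defined.

Definition mono (C : Category) (A B : C) (m : Hom A B) : Prop :=
  forall (T : C) (u v : Hom T A), m ∘ u = m ∘ v -> u = v.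

Definition iso (C : Category) (A B : C) (f : Hom A B) : Prop :=
  exists g : Hom B A, g ∘ f = idm A /\ f ∘ g = idm B.

(** * Finite limits *)

Record cone (J C : Category) (D : Functor J C) : Type := mkCone {
  apex : C;
  leg : forall j : J, Hom apex (D j);
  leg_nat : forall (i j : J) (u : Hom i j), fmap D u ∘ leg i = leg j
}.

Arguments leg {J C D} _ _.

Definition is_limit (J C : Category) (D : Functor J C) (c : cone D) : Prop :=
  forall c' : cone D,
    exists! h : Hom (apex c') (apex c), forall j : J, leg c j ∘ h = leg c' j.

Definition map_cone (J C C' : Category) (D : Functor J C) (F : Functor C C')
    (c : cone D) : cone (functor_comp F D).
Proof.
refine (@mkCone J C' (functor_comp F D) (F (apex c)) (fun j => fmap F (leg c j)) _).
intros i j u; simpl; now rewrite <- fmap_comp, leg_nat.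
Defined.

Definition finite_category (J : Category) : Prop :=
  Finite J /\ forall i j : J, Finite (Hom i j).

Definition has_finite_limits (C : Category) : Prop :=
  forall J : Category, finite_category J ->
  forall D : Functor J C, exists c : cone D, is_limit c.

Definition preserves_finite_limits (C C' : Category) (F : Functor C C') : Prop :=
  forall J : Category, finite_category J ->
  forall (D : Functor J C) (c : cone D), is_limit c -> is_limit (map_cone F c).

(** * Coherent functors *)

Definition jointly_strongly_epic (C : Category) (X Y Z : C)
    (f : Hom X Z) (g : Hom Y Z) : Prop :=
  forall (M : C) (m : Hom M Z), mono m ->
    (exists f' : Hom X M, m ∘ f' = f) ->
    (exists g' : Hom Y M, m ∘ g' = g) ->
    iso m.

Definition preserves_jointly_strongly_epic (C C' : Category) (F : Functor C C') : Prop :=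
  forall (X Y Z : C) (f : Hom X Z) (g : Hom Y Z),
    jointly_strongly_epic f g -> jointly_strongly_epic (fmap F f) (fmap F g).

(** The proofs [HC] and [HC'] only record that the notion is restricted to
    functors between categories with finite limits. *)
Definition coherent_functor (C C' : Category)
    (HC : has_finite_limits C) (HC' : has_finite_limits C') (F : Functor C C') : Prop :=
  preserves_finite_limits F /\ preserves_jointly_strongly_epic F.

(** * Pullbacks *)

Definition is_pullback (C : Category) (A B Z P : C)
    (f : Hom A Z) (g : Hom B Z) (p : Hom P A) (q : Hom P B) : Prop :=
  f ∘ p = g ∘ q /\
  forall (T : C) (u : Hom T A) (v : Hom T B), f ∘ u = g ∘ v ->
    exists! h : Hom T P, p ∘ h = u /\ q ∘ h = v.

Record pullback (C : Category) (A B Z : C) (f : Hom A Z) (g : Hom B Z) : Type :=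
  mkPullback {
    pb_ob : C;
    pb_fst : Hom pb_ob A;
    pb_snd : Hom pb_ob B;
    pb_is : is_pullback f g pb_fst pb_snd
  }.

Arguments pb_ob {C A B Z f g} _.
Arguments pb_fst {C A B Z f g} _.
Arguments pb_snd {C A B Z f g} _.

Inductive cospan_ob : Set := csL | csR | csZ.

Definition cospan_hom (a b : cospan_ob) : Set :=
  match a, b with
  | csL, csL | csR, csR | csZ, csZ | csL, csZ | csR, csZ => unit
  | _, _ => Empty_set
  end.

Definition cospan_cat : Category.
Proof.
refine (@mkCategory cospan_ob cospan_hom _ _ _ _ _).
Unshelve.
4: { intros []; exact tt. }
4: { intros [] [] []; simpl; intros x y; solve [exact tt | destruct x | destruct y]. }
- intros [] [] []; reflexivity.
- intros [] [] []; reflexivity.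
- intros [] [] [] [] [] [] []; reflexivity.
Defined.

Lemma cospan_finite : finite_category cospan_cat.
Proof.
split.
- exists (csL :: csR :: csZ :: nil); intros []; simpl; auto.
- intros [] []; simpl; solve
    [ exists (tt :: nil); intros []; simpl; auto | exists nil; intros [] ].
Qed.

Definition cospan_diagram (C : Category) (A B Z : C) (f : Hom A Z) (g : Hom B Z) :
  Functor cospan_cat C.
Proof.
refine (@mkFunctor cospan_cat C
  (fun a => match a with csL => A | csR => B | csZ => Z end)
  (fun a b => match a, b with
     | csL, csL => fun _ => idm A
     | csR, csR => fun _ => idm B
     | csZ, csZ => fun _ => idm Z
     | csL, csZ => fun _ => f
     | csR, csZ => fun _ => g
     | _, _ => fun e : Empty_set => match e with end
     end) _ _).
- intros []; reflexivity.
- intros [] [] [] [] []; simpl; now rewrite ?comp_idl, ?comp_idr.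
Defined.

Lemma has_pullbacks (C : Category) (HC : has_finite_limits C) (A B Z : C)
    (f : Hom A Z) (g : Hom B Z) : exists P : pullback f g, True.
Proof.
destruct (HC _ cospan_finite (cospan_diagram f g)) as [c Hc].
assert (EL : f ∘ leg c csL = leg c csZ) by exact (@leg_nat _ _ _ c csL csZ tt).
assert (ER : g ∘ leg c csR = leg c csZ) by exact (@leg_nat _ _ _ c csR csZ tt).
unshelve eexists (@mkPullback C A B Z f g (apex c) (leg c csL) (leg c csR) _);
  [|exact I].
split; [congruence|].
intros T u v E.
unshelve epose (c' := @mkCone cospan_cat C (cospan_diagram f g) T
  (fun j => match j with csL => u | csR => v | csZ => f ∘ u end) _).
{ intros [] [] []; simpl; now rewrite ?comp_idl. }
destruct (Hc c') as [h [Hh Uh]].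
exists h; split.
- split; [exact (Hh csL) | exact (Hh csR)].
- intros h' [H1 H2]; apply Uh; intros []; simpl; auto.
  exact (eq_trans (f_equal (fun x => x ∘ h') (eq_sym EL))
    (eq_trans (eq_sym (comp_assoc f (leg c csL) h')) (f_equal (comp f) H1))).
Qed.

Definition chosen_pullback (C : Category) (HC : has_finite_limits C) (A B Z : C)
    (f : Hom A Z) (g : Hom B Z) : pullback f g :=
  proj1_sig (constructive_indefinite_description _ (has_pullbacks HC f g)).

Definition pb_lift (C : Category) (A B Z : C) (f : Hom A Z) (g : Hom B Z)
    (P : pullback f g) (T : C) (u : Hom T A) (v : Hom T B) (E : f ∘ u = g ∘ v) :
    Hom T (pb_ob P) :=
  proj1_sig (constructive_definite_description _ (proj2 (pb_is P) T u v E)).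

Lemma pb_comm (C : Category) (A B Z : C) (f : Hom A Z) (g : Hom B Z)
    (P : pullback f g) : f ∘ pb_fst P = g ∘ pb_snd P.
Proof. exact (proj1 (pb_is P)). Qed.

Lemma pb_lift_fst (C : Category) (A B Z : C) (f : Hom A Z) (g : Hom B Z)
    (P : pullback f g) (T : C) (u : Hom T A) (v : Hom T B) (E : f ∘ u = g ∘ v) :
  pb_fst P ∘ pb_lift P E = u.
Proof. exact (proj1 (proj2_sig (constructive_definite_description _
  (proj2 (pb_is P) T u v E)))). Qed.

Lemma pb_lift_snd (C : Category) (A B Z : C) (f : Hom A Z) (g : Hom B Z)
    (P : pullback f g) (T : C) (u : Hom T A) (v : Hom T B) (E : f ∘ u = g ∘ v) :
  pb_snd P ∘ pb_lift P E = v.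
Proof. exact (proj2 (proj2_sig (constructive_definite_description _
  (proj2 (pb_is P) T u v E)))). Qed.

Lemma pb_ext (C : Category) (A B Z : C) (f : Hom A Z) (g : Hom B Z)
    (P : pullback f g) (T : C) (h k : Hom T (pb_ob P)) :
  pb_fst P ∘ h = pb_fst P ∘ k -> pb_snd P ∘ h = pb_snd P ∘ k -> h = k.
Proof.
intros E1 E2.
assert (E : f ∘ (pb_fst P ∘ h) = g ∘ (pb_snd P ∘ h))
  by now rewrite !comp_assoc, pb_comm.
destruct (proj2 (pb_is P) _ _ _ E) as [l [_ U]].
transitivity l; [symmetry|]; apply U; auto.
Qed.

(** * Slice categories and change of base *)

Record slice_ob (C : Category) (X : C) : Type := mkSlice {
  sl_ob : C;
  sl_arr : Hom sl_ob X
}.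

Arguments sl_ob {C X} _.
Arguments sl_arr {C X} _.

Definition slice_hom (C : Category) (X : C) (A B : slice_ob X) : Type :=
  {h : Hom (sl_ob A) (sl_ob B) | sl_arr B ∘ h = sl_arr A}.

Lemma sig_ext (T : Type) (P : T -> Prop) (x y : {t : T | P t}) :
  proj1_sig x = proj1_sig y -> x = y.
Proof. apply eq_sig_hprop; intros; apply proof_irrelevance. Qed.

Definition Slice (C : Category) (X : C) : Category.
Proof.
refine (@mkCategory (slice_ob X) (@slice_hom C X)
  (fun A => exist _ (idm (sl_ob A)) (comp_idr (sl_arr A)))
  (fun A B D g f => exist _ (proj1_sig g ∘ proj1_sig f) _) _ _ _).
Unshelve.
- intros; apply sig_ext, comp_idl.
- intros; apply sig_ext, comp_idr.
- intros; apply sig_ext, comp_assoc.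
- now rewrite comp_assoc, (proj2_sig g), (proj2_sig f).
Defined.

Section SliceChangeOfBase.
Variables (C : Category) (HC : has_finite_limits C) (X Y : C) (f : Hom X Y).

Definition slice_cb_ob (A : Slice Y) : Slice X :=
  mkSlice (pb_fst (chosen_pullback HC f (sl_arr A))).

Lemma slice_cb_eq (A B : Slice Y) (h : Hom A B) :
  f ∘ pb_fst (chosen_pullback HC f (sl_arr A)) =
  sl_arr B ∘ (proj1_sig h ∘ pb_snd (chosen_pullback HC f (sl_arr A))).
Proof. now rewrite comp_assoc, (proj2_sig h), pb_comm. Qed.

Definition slice_cb_hom (A B : Slice Y) (h : Hom A B) :
    Hom (slice_cb_ob A) (slice_cb_ob B) :=
  exist (fun k => sl_arr (slice_cb_ob B) ∘ k = sl_arr (slice_cb_ob A))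
    (pb_lift (chosen_pullback HC f (sl_arr B)) (slice_cb_eq h))
    (pb_lift_fst _ (slice_cb_eq h)).

Definition slice_change_of_base : Functor (Slice Y) (Slice X).
Proof.
refine (@mkFunctor (Slice Y) (Slice X) slice_cb_ob slice_cb_hom _ _).
- intros A; apply sig_ext; simpl; apply pb_ext;
    now rewrite ?pb_lift_fst, ?pb_lift_snd, comp_idr; simpl; rewrite ?comp_idl.
- intros A B D g h; apply sig_ext; simpl; apply pb_ext;
    rewrite (comp_assoc _ (pb_lift _ _) (pb_lift _ _)).
  + now rewrite !pb_lift_fst.
  + now rewrite !pb_lift_snd, <- !comp_assoc, pb_lift_snd.
Defined.

End SliceChangeOfBase.

(** * Categories of points and change of base *)

Record point (C : Category) (X : C) : Type := mkPoint {
  pt_ob : C;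
  pt_pr : Hom pt_ob X;
  pt_sec : Hom X pt_ob;
  pt_split : pt_pr ∘ pt_sec = idm X
}.

Arguments pt_ob {C X} _.
Arguments pt_pr {C X} _.
Arguments pt_sec {C X} _.

Definition point_hom (C : Category) (X : C) (A B : point X) : Type :=
  {h : Hom (pt_ob A) (pt_ob B) | pt_pr B ∘ h = pt_pr A /\ h ∘ pt_sec A = pt_sec B}.

Definition Pt (C : Category) (X : C) : Category.
Proof.
refine (@mkCategory (point X) (@point_hom C X)
  (fun A => exist _ (idm (pt_ob A)) (conj (comp_idr (pt_pr A)) (comp_idl (pt_sec A))))
  (fun A B D g f => exist _ (proj1_sig g ∘ proj1_sig f) _) _ _ _).
Unshelve.
- intros; apply sig_ext, comp_idl.
- intros; apply sig_ext, comp_idr.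
- intros; apply sig_ext, comp_assoc.
- destruct g as [g [g1 g2]], f as [f [f1 f2]]; simpl; split.
  + now rewrite comp_assoc, g1, f1.
  + now rewrite <- comp_assoc, f2, g2.
Defined.

Section PointChangeOfBase.
Variables (C : Category) (HC : has_finite_limits C) (X Y : C) (f : Hom X Y).

Lemma pt_cb_sec_eq (A : Pt Y) : f ∘ idm X = pt_pr A ∘ (pt_sec A ∘ f).
Proof. now rewrite comp_assoc, pt_split, comp_idl, comp_idr. Qed.

(** The pullback of [(A, p, s)] has the section induced by [1_X] and [s f]. *)
Definition pt_cb_ob (A : Pt Y) : Pt X :=
  mkPoint (pb_lift_fst (chosen_pullback HC f (pt_pr A)) (pt_cb_sec_eq A)).

Lemma pt_cb_eq (A B : Pt Y) (h : Hom A B) :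
  f ∘ pb_fst (chosen_pullback HC f (pt_pr A)) =
  pt_pr B ∘ (proj1_sig h ∘ pb_snd (chosen_pullback HC f (pt_pr A))).
Proof. now rewrite comp_assoc, (proj1 (proj2_sig h)), pb_comm. Qed.

Lemma pt_cb_hom_sec (A B : Pt Y) (h : Hom A B) :
  pb_lift (chosen_pullback HC f (pt_pr B)) (pt_cb_eq h) ∘ pt_sec (pt_cb_ob A) =
  pt_sec (pt_cb_ob B).
Proof.
simpl; apply pb_ext; rewrite comp_assoc, ?pb_lift_fst, ?pb_lift_snd; auto.
rewrite <- comp_assoc, pb_lift_snd, comp_assoc.
now rewrite (proj2 (proj2_sig h)).
Qed.

Definition pt_cb_hom (A B : Pt Y) (h : Hom A B) : Hom (pt_cb_ob A) (pt_cb_ob B) :=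
  exist (fun k => pt_pr (pt_cb_ob B) ∘ k = pt_pr (pt_cb_ob A) /\
                  k ∘ pt_sec (pt_cb_ob A) = pt_sec (pt_cb_ob B))
    (pb_lift (chosen_pullback HC f (pt_pr B)) (pt_cb_eq h))
    (conj (pb_lift_fst _ (pt_cb_eq h)) (pt_cb_hom_sec h)).

Definition pt_change_of_base : Functor (Pt Y) (Pt X).
Proof.
refine (@mkFunctor (Pt Y) (Pt X) pt_cb_ob pt_cb_hom _ _).
- intros A; apply sig_ext; simpl; apply pb_ext;
    now rewrite ?pb_lift_fst, ?pb_lift_snd, comp_idr; simpl; rewrite ?comp_idl.
- intros A B D g h; apply sig_ext; simpl; apply pb_ext;
    rewrite (comp_assoc _ (pb_lift _ _) (pb_lift _ _)).
  + now rewrite !pb_lift_fst.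
  + now rewrite !pb_lift_snd, <- !comp_assoc, pb_lift_snd.
Defined.

End PointChangeOfBase.

(** * Finite limits in slices and in categories of points *)

(** [J] with a terminal object adjoined: a diagram in [Slice X] is a diagram
    of this shape in the base category, with value [X] at the new object. *)
Definition add_top_hom (J : Category) (a b : option J) : Type :=
  match a, b with
  | Some i, Some j => Hom i j
  | _, None => unit
  | None, Some _ => Empty_set
  end.

Definition add_top (J : Category) : Category.
Proof.
refine (@mkCategory (option J) (@add_top_hom J)
  (fun a => match a with Some i => idm i | None => tt end)
  (fun a b c => match a, b, c with
    | Some i, Some j, Some k => fun g f => g ∘ f
    | Some _, _, None => fun _ _ => tt
    | None, _, None => fun _ _ => tt
    | None, Some _, Some _ => fun _ f => match f : Empty_set with end
    | _, None, Some _ => fun g _ => match g : Empty_set with end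
    end) _ _ _).
- intros [i|] [j|] u; simpl in *; try destruct u; auto using comp_idl.
- intros [i|] [j|] u; simpl in *; try destruct u; auto using comp_idr.
- intros [i|] [j|] [k|] [l|] w v u; simpl in *;
    try destruct u; try destruct v; try destruct w; auto using comp_assoc.
Defined.

Lemma add_top_finite (J : Category) : finite_category J -> finite_category (add_top J).
Proof.
intros [[l Hl] HH]; split.
- exists (None :: map Some l); intros [i|]; simpl; auto.
  right; apply in_map, Hl.
- intros [i|] [j|]; simpl; auto.
  + exists (tt :: nil); intros []; simpl; auto.
  + exists nil; intros [].
  + exists (tt :: nil); intros []; simpl; auto.
Qed.

Definition top_diagram (C : Category) (X : C) (J : Category) (D : Functor J (Slice X)) :
  Functor (add_top J) C.
Proof.
refine (@mkFunctor (add_top J) C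
  (fun a => match a with Some i => sl_ob (D i) | None => X end)
  (fun a b => match a, b with
    | Some i, Some j => fun u => proj1_sig (fmap D u)
    | Some i, None => fun _ => sl_arr (D i)
    | None, None => fun _ => idm X
    | None, Some _ => fun u => match u : Empty_set with end
    end) _ _).
- intros [i|]; simpl; auto; now rewrite fmap_id.
- intros [i|] [j|] [k|] v u; simpl in *;
    try destruct u; try destruct v; rewrite ?comp_idl; auto.
  + now rewrite fmap_comp.
  + now rewrite (proj2_sig (fmap D u)).
Defined.

Lemma slice_has_finite_limits (C : Category) (HC : has_finite_limits C) (X : C) :
  has_finite_limits (Slice X).
Proof.
intros J HJ D.
destruct (HC _ (add_top_finite HJ) (top_diagram D)) as [c Hc].
unshelve eexists (@mkCone J (Slice X) D
  (mkSlice (leg c None : Hom (apex c) X)) (fun j => exist _ (leg c (Some j)) _) _).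
{ exact (@leg_nat _ _ _ c (Some j) None tt). }
{ intros i j u; apply sig_ext; exact (@leg_nat _ _ _ c (Some i) (Some j) u). }
intros c'.
unshelve epose (t := @mkCone (add_top J) C (top_diagram D) (sl_ob (apex c'))
  (fun a => match a with Some j => proj1_sig (leg c' j) | None => sl_arr (apex c') end) _).
{ intros [i|] [j|] u; simpl in *; try destruct u.
  - exact (f_equal (@proj1_sig _ _) (leg_nat c' u)).
  - exact (proj2_sig (leg c' i)).
  - apply comp_idl. }
destruct (Hc t) as [h [Hh Uh]].
exists (exist _ h (Hh None)); split.
- intros j; apply sig_ext; exact (Hh (Some j)).
- intros k Hk; apply sig_ext; simpl; apply Uh; intros [j|].
  + exact (f_equal (@proj1_sig _ _) (Hk j)).
  + exact (proj2_sig k).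
Qed.

Arguments slice_has_finite_limits {C} HC X.

Definition pt_forget (C : Category) (X : C) : Functor (Pt X) (Slice X).
Proof.
refine (@mkFunctor (Pt X) (Slice X) (fun A => mkSlice (pt_pr A))
  (fun A B h => exist _ (proj1_sig h) (proj1 (proj2_sig h))) _ _);
  intros; now apply sig_ext.
Defined.

Lemma pt_has_finite_limits (C : Category) (HC : has_finite_limits C) (X : C) :
  has_finite_limits (Pt X).
Proof.
intros J HJ D.
destruct (slice_has_finite_limits HC X J HJ (functor_comp (pt_forget X) D)) as [c Hc].
unshelve epose (t := @mkCone J (Slice X) (functor_comp (pt_forget X) D)
  (mkSlice (idm X)) (fun j => exist _ (pt_sec (D j)) (pt_split (D j))) _).
{ intros i j u; apply sig_ext; exact (proj2 (proj2_sig (fmap D u))). }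
destruct (Hc t) as [s [Hs _]].
unshelve eexists (@mkCone J (Pt X) D
  (@mkPoint C X (sl_ob (apex c)) (sl_arr (apex c)) (proj1_sig s) (proj2_sig s))
  (fun j => exist _ (proj1_sig (leg c j)) _) _).
{ split; [exact (proj2_sig (leg c j)) | exact (f_equal (@proj1_sig _ _) (Hs j))]. }
{ intros i j u; apply sig_ext; exact (f_equal (@proj1_sig _ _) (leg_nat c u)). }
intros c'.
destruct (Hc (map_cone (pt_forget X) c')) as [h [Hh Uh]].
assert (Es : proj1_sig h ∘ pt_sec (apex c') = proj1_sig s).
{ destruct (Hc t) as [s' [_ Us]].
  transitivity (proj1_sig s'); [symmetry|]; [|now rewrite (Us s Hs)].
  unshelve epose (k := exist _ (proj1_sig h ∘ pt_sec (apex c')) _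
    : @Hom (Slice X) (apex t) (apex c)).
  { exact (eq_trans (comp_assoc (sl_arr (apex c)) (proj1_sig h) (pt_sec (apex c')))
      (eq_trans (f_equal (fun x => x ∘ pt_sec (apex c')) (proj2_sig h))
        (pt_split (apex c')))). }
  change (proj1_sig s' = proj1_sig k); f_equal; apply Us.
  intros j; apply sig_ext.
  exact (eq_trans (comp_assoc (proj1_sig (leg c j)) (proj1_sig h) (pt_sec (apex c')))
    (eq_trans (f_equal (fun x => proj1_sig x ∘ pt_sec (apex c')) (Hh j))
      (proj2 (proj2_sig (leg c' j))))). }
exists (exist _ (proj1_sig h) (conj (proj2_sig h) Es)); split.
- intros j; apply sig_ext; exact (f_equal (@proj1_sig _ _) (Hh j)).
- intros k Hk; apply sig_ext; simpl.
  change (proj1_sig h = proj1_sig (fmap (pt_forget X) k)); f_equal; apply Uh.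
  intros j; apply sig_ext; exact (f_equal (@proj1_sig _ _) (Hk j)).
Qed.

Arguments pt_has_finite_limits {C} HC X.

(** * Regular and coherent categories *)

Definition is_coequalizer (C : Category) (A B Q : C)
    (u v : Hom A B) (e : Hom B Q) : Prop :=
  e ∘ u = e ∘ v /\
  forall (T : C) (k : Hom B T), k ∘ u = k ∘ v -> exists! h : Hom Q T, h ∘ e = k.

Definition regular_epi (C : Category) (B Q : C) (e : Hom B Q) : Prop :=
  exists (A : C) (u v : Hom A B), is_coequalizer u v e.

Record regular_category (C : Category) : Prop := mkRegular {
  regular_limits : has_finite_limits C;
  regular_coequalizers : forall (A B K : C) (f : Hom A B) (p q : Hom K A),
    is_pullback f f p q -> exists (Q : C) (e : Hom A Q), is_coequalizer p q e;
  regular_stable : forall (A B Z P : C) (f : Hom A Z) (e : Hom B Z)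
    (p : Hom P A) (q : Hom P B),
    is_pullback f e p q -> regular_epi e -> regular_epi p
}.

Definition has_finite_coproducts (C : Category) : Prop :=
  forall (I : Type) (A : I -> C), Finite I ->
    exists (S : C) (inj : forall i, Hom (A i) S),
      forall (T : C) (k : forall i, Hom (A i) T),
        exists! h : Hom S T, forall i, h ∘ inj i = k i.

Record coherent_category (C : Category) : Prop := mkCoherent {
  coherent_regular : regular_category C;
  coherent_coproducts : has_finite_coproducts C;
  coherent_base : forall (X Y : C) (f : Hom X Y),
    coherent_functor
      (slice_has_finite_limits (regular_limits coherent_regular) Y)
      (slice_has_finite_limits (regular_limits coherent_regular) X)
      (slice_change_of_base (regular_limits coherent_regular) f)
}.

Record algebraically_coherent (C : Category) : Prop := mkAlgCoherent {
  algcoh_limits : has_finite_limits C;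
  algcoh_base : forall (X Y : C) (f : Hom X Y),
    coherent_functor (pt_has_finite_limits algcoh_limits Y)
      (pt_has_finite_limits algcoh_limits X)
      (pt_change_of_base algcoh_limits f)
}.

(* Main.v *)
Require Import Defs.
From Stdlib Require Import List FinFun ClassicalEpsilon ProofIrrelevance.

Set Implicit Arguments.
Unset Strict Implicit.
Unset Printing Implicit Defensive.

(** Points over [X] are compared with arbitrary objects over [X] by means of
    the forgetful functor [U : Pt X -> Slice X], which commutes with change of
    base. It therefore suffices to see that [U] preserves and reflects finite
    limits and jointly strongly epic pairs: coherence of the change of base
    between slices then passes to the one between categories of points.

    Preservation of limits and of monomorphisms comes from a left adjoint: the
    coproduct [T + X], with the injection of [X] as section, is the free point
    on an object [T] over [X] ([free_points]). Reflection of limits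
    ([pt_forget_reflects_limits]) holds because the legs of a limit cone are
    jointly monic, which forces the comparison morphism to respect sections.

    For a jointly strongly epic pair [u : A -> Z], [v : B -> Z] of points, the
    key remark is that a subobject of [Z] over [X] containing the image of [u]
    contains the section of [Z], so it is itself a subobject in the category of
    points ([pt_forget_preserves_jse]). Conversely a monomorphism of points is
    one over [X] by the adjunction, and an inverse over [X] of a morphism of
    points respects sections ([pt_forget_reflects_jse]). *)

(** * Right adjoints *)

(** Existence of a left adjoint, as a universal arrow from each object: this
    form avoids choosing the left adjoint on morphisms. *)
Definition has_left_adjoint (C D : Category) (G : Functor D C) : Prop :=
  forall T : C, exists (P : D) (eta : Hom T (G P)),
    forall (Q : D) (k : Hom T (G Q)), exists! h : Hom P Q, fmap G h ∘ eta = k.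

Lemma right_adjoint_preserves_mono (C D : Category) (G : Functor D C) :
  has_left_adjoint G ->
  forall (A B : D) (m : Hom A B), mono m -> mono (fmap G m).
Proof.
intros HG A B m Hm T a b E.
destruct (HG T) as [P [eta HP]].
destruct (HP A a) as [a' [Ea _]], (HP A b) as [b' [Eb _]].
assert (Eab : a' = b').
{ apply Hm.
  destruct (HP B (fmap G m ∘ a)) as [k [_ Uk]].
  transitivity k; [symmetry|]; apply Uk.
  - now rewrite fmap_comp, <- comp_assoc, Ea.
  - now rewrite fmap_comp, <- comp_assoc, Eb. }
now rewrite <- Ea, <- Eb, Eab.
Qed.

Lemma right_adjoint_preserves_limits (C D : Category) (G : Functor D C) :
  has_left_adjoint G ->
  forall (J : Category) (E : Functor J D) (c : cone E),
    is_limit c -> is_limit (map_cone G c).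
Proof.
intros HG J E c Hc c'.
destruct (HG (apex c')) as [P [eta HP]].
(* The transposed cone, with the free object on the given apex as apex. *)
set (l := fun j => proj1_sig
  (constructive_definite_description _ (HP (E j) (leg c' j)))).
assert (Hl : forall j, fmap G (l j) ∘ eta = leg c' j)
  by (intros j; apply proj2_sig).
unshelve epose (t := @mkCone J D E P l _).
{ intros i j u.
  destruct (HP (E j) (leg c' j)) as [k [_ Uk]].
  transitivity k; [symmetry|]; apply Uk; [|apply Hl].
  rewrite fmap_comp, <- comp_assoc, Hl; exact (leg_nat c' u). }
destruct (Hc t) as [h [Hh Uh]].
exists (fmap G h ∘ eta); split.
- intros j; simpl; rewrite comp_assoc, <- fmap_comp, Hh; apply Hl.
- intros k Hk.
  destruct (HP (apex c) k) as [k' [Ek _]].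
  rewrite <- Ek; f_equal; f_equal; apply Uh; intros j.
  change (leg c j ∘ k' = l j).
  destruct (HP (E j) (leg c' j)) as [z [_ Uz]].
  transitivity z; [symmetry|]; apply Uz; [|apply Hl].
  rewrite fmap_comp, <- comp_assoc, Ek; apply Hk.
Qed.

(** * Points and objects over the base *)

Lemma bool_finite : Finite bool.
Proof. exists (true :: false :: nil); intros []; simpl; auto. Qed.

Lemma binary_coproduct (C : Category) (HS : has_finite_coproducts C) (A B : C) :
  exists (S : C) (inl : Hom A S) (inr : Hom B S),
    forall (T : C) (a : Hom A T) (b : Hom B T),
      exists! h : Hom S T, h ∘ inl = a /\ h ∘ inr = b.
Proof.
destruct (HS bool (fun i => if i then A else B) bool_finite) as [S [inj HI]].
exists S, (inj true), (inj false); intros T a b.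
destruct (HI T (fun i => match i return Hom (if i then A else B) T with
  | true => a | false => b end)) as [h [Hh Uh]].
exists h; split.
- split; [exact (Hh true) | exact (Hh false)].
- intros k [Ha Hb]; apply Uh; intros []; assumption.
Qed.

(** The free point on [T] over [X] is the coproduct [T + X]: the projection is
    the identity on [X], and a morphism of points out of it is prescribed on
    [X] by the sections. *)
Lemma free_points (C : Category) (HS : has_finite_coproducts C) (X : C) :
  has_left_adjoint (pt_forget X).
Proof.
intros T.
destruct (binary_coproduct HS (sl_ob T) X) as [S [i [s HI]]].
destruct (HI X (sl_arr T) (idm X)) as [p [[pi ps] _]].
unshelve eexists (mkPoint ps : Pt X), (exist _ i _); [exact pi|].
intros Q [k Hk].
destruct (HI (pt_ob Q) k (pt_sec Q)) as [h [[hi hs] Uh]].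
assert (hp : pt_pr Q ∘ h = p).
{ destruct (HI X (sl_arr T) (idm X)) as [q [_ Uq]].
  transitivity q; [symmetry|]; apply Uq; auto.
  rewrite <- !comp_assoc, hi, hs; auto using pt_split. }
exists (exist _ h (conj hp hs)); split.
- now apply sig_ext.
- intros [g [gp gs]] Hg; apply sig_ext; apply Uh; split; auto.
  exact (f_equal (@proj1_sig _ _) Hg).
Qed.

Lemma pt_forget_reflects_limits (C : Category) (X : C) (J : Category)
    (D : Functor J (Pt X)) (c : cone D) :
  is_limit (map_cone (pt_forget X) c) -> is_limit c.
Proof.
intros Hc c'.
destruct (Hc (map_cone (pt_forget X) c')) as [h [Hh Uh]].
(* Both composites are factorizations of the cone of sections through [c]. *)
assert (Es : proj1_sig h ∘ pt_sec (apex c') = pt_sec (apex c)).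
{ unshelve epose (t := @mkCone J (Slice X) (functor_comp (pt_forget X) D)
    (mkSlice (idm X)) (fun j => exist _ (pt_sec (D j)) (pt_split (D j))) _).
  { intros i j u; apply sig_ext; exact (proj2 (proj2_sig (fmap D u))). }
  unshelve epose (k := exist _ (proj1_sig h ∘ pt_sec (apex c')) _
    : @Hom (Slice X) (apex t) (apex (map_cone (pt_forget X) c))).
  { exact (eq_trans (comp_assoc (pt_pr (apex c)) (proj1_sig h) (pt_sec (apex c')))
      (eq_trans (f_equal (fun x => x ∘ pt_sec (apex c')) (proj2_sig h))
        (pt_split (apex c')))). }
  pose (k' := exist _ (pt_sec (apex c)) (pt_split (apex c))
    : @Hom (Slice X) (apex t) (apex (map_cone (pt_forget X) c))).
  destruct (Hc t) as [s [_ Us]].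
  change (proj1_sig k = proj1_sig k'); f_equal.
  transitivity s; [symmetry|]; apply Us; intros j; apply sig_ext.
  - exact (eq_trans (comp_assoc (proj1_sig (leg c j)) (proj1_sig h) (pt_sec (apex c')))
      (eq_trans (f_equal (fun x => proj1_sig x ∘ pt_sec (apex c')) (Hh j))
        (proj2 (proj2_sig (leg c' j))))).
  - exact (proj2 (proj2_sig (leg c j))). }
exists (exist _ (proj1_sig h) (conj (proj2_sig h) Es)); split.
- intros j; apply sig_ext; exact (f_equal (@proj1_sig _ _) (Hh j)).
- intros k Hk; apply sig_ext.
  change (proj1_sig h = proj1_sig (fmap (pt_forget X) k)); f_equal; apply Uh.
  intros j; apply sig_ext; exact (f_equal (@proj1_sig _ _) (Hk j)).
Qed.

(** * Jointly strongly epic pairs of points *)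

(** If [u] and [v] factor through a monomorphism [m : M -> Z] over [X] as [u']
    and [v'], then [u' s_A] and [v' s_B] agree, since [m] sends both to the
    section of [Z]. They make [M] a point, and [m], [u'], [v'] morphisms of
    points. *)
Lemma pt_forget_preserves_jse (C : Category) (X : C) :
  preserves_jointly_strongly_epic (pt_forget X).
Proof.
intros A B Z u v Huv M m Hm [u' Eu] [v' Ev].
apply (f_equal (@proj1_sig _ _)) in Eu; apply (f_equal (@proj1_sig _ _)) in Ev.
destruct u as [u [up us]], v as [v [vp vs]], u' as [u' up'], v' as [v' vp'].
destruct m as [m mp]; simpl in *.
assert (ms : m ∘ (u' ∘ pt_sec A) = pt_sec Z)
  by now rewrite comp_assoc, Eu.
assert (ps : sl_arr M ∘ (u' ∘ pt_sec A) = idm X)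
  by now rewrite comp_assoc, up', pt_split.
assert (vps : sl_arr M ∘ (v' ∘ pt_sec B) = idm X)
  by now rewrite comp_assoc, vp', pt_split.
assert (Es : v' ∘ pt_sec B = u' ∘ pt_sec A).
{ set (a := exist _ _ vps : @Hom (Slice X) (mkSlice (idm X)) M).
  set (b := exist _ _ ps : @Hom (Slice X) (mkSlice (idm X)) M).
  change (proj1_sig a = proj1_sig b); f_equal; apply Hm, sig_ext; simpl.
  now rewrite ms, comp_assoc, Ev. }
set (N := mkPoint ps : Pt X).
set (n := exist _ m (conj mp ms) : @Hom (Pt X) N Z).
destruct (Huv N n) as [g [gn ng]].
- intros T a b E.
  apply sig_ext; change (proj1_sig (fmap (pt_forget X) a) = proj1_sig (fmap (pt_forget X) b)).
  f_equal; apply Hm, sig_ext; exact (f_equal (@proj1_sig _ _) E).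
- exists (exist _ u' (conj up' eq_refl) : @Hom (Pt X) A N); now apply sig_ext.
- exists (exist _ v' (conj vp' Es) : @Hom (Pt X) B N); now apply sig_ext.
- exists (fmap (pt_forget X) g); split; apply sig_ext.
  + exact (f_equal (@proj1_sig _ _) gn).
  + exact (f_equal (@proj1_sig _ _) ng).
Qed.

(** If [m s_A = s_B] and [g] is inverse to [m], then [g s_B = g m s_A = s_A]. *)
Lemma pt_forget_reflects_iso (C : Category) (X : C) (A B : Pt X) (m : Hom A B) :
  iso (fmap (pt_forget X) m) -> iso m.
Proof.
intros [[g gp] [gm mg]].
apply (f_equal (@proj1_sig _ _)) in gm; apply (f_equal (@proj1_sig _ _)) in mg.
destruct m as [m [mp ms]]; simpl in *.
assert (gs : g ∘ pt_sec B = pt_sec A)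
  by now rewrite <- ms, comp_assoc, gm, comp_idl.
exists (exist _ g (conj gp gs)); split; now apply sig_ext.
Qed.

Lemma pt_forget_reflects_jse (C : Category) (HS : has_finite_coproducts C) (X : C)
    (A B Z : Pt X) (u : Hom A Z) (v : Hom B Z) :
  jointly_strongly_epic (fmap (pt_forget X) u) (fmap (pt_forget X) v) ->
  jointly_strongly_epic u v.
Proof.
intros Huv M m Hm [u' Eu] [v' Ev].
apply pt_forget_reflects_iso, Huv.
- exact (right_adjoint_preserves_mono (free_points (X := X) HS) Hm).
- exists (fmap (pt_forget X) u'); now rewrite <- fmap_comp, Eu.
- exists (fmap (pt_forget X) v'); now rewrite <- fmap_comp, Ev.
Qed.

(** * Change of base *)

(** The two functors agree definitionally on objects; on morphisms they differ
    only in the proof handed to the universal property of the pullback. *)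
Lemma pt_forget_change_of_base (C : Category) (HC : has_finite_limits C) (X Y : C)
    (f : Hom X Y) (A B : Pt Y) (h : Hom A B) :
  fmap (pt_forget X) (fmap (pt_change_of_base HC f) h) =
  fmap (slice_change_of_base HC f) (fmap (pt_forget Y) h).
Proof.
apply sig_ext; simpl; f_equal; apply proof_irrelevance.
Qed.

Lemma pt_change_of_base_limits (C : Category) (HC : has_finite_limits C)
    (HS : has_finite_coproducts C) (X Y : C) (f : Hom X Y) :
  preserves_finite_limits (slice_change_of_base HC f) ->
  preserves_finite_limits (pt_change_of_base HC f).
Proof.
intros Hf J HJ D c Hc.
apply pt_forget_reflects_limits; intros c'.
pose proof (Hf J HJ _ _ (right_adjoint_preserves_limits (free_points (X := Y) HS) Hc)) as Hl.
(* The same legs form a cone over the other composite diagram, whose morphisms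
   are equal to those of the first one but not convertible to them. *)
unshelve epose (t := @mkCone J (Slice X)
  (functor_comp (slice_change_of_base HC f) (functor_comp (pt_forget Y) D))
  (apex c') (leg c') _).
{ intros i j u.
  exact (eq_trans (f_equal (fun x => x ∘ leg c' i)
    (eq_sym (pt_forget_change_of_base HC f (fmap D u)))) (leg_nat c' u)). }
destruct (Hl t) as [h [Hh Uh]].
exists h; split.
- intros j; exact (eq_trans (f_equal (fun x => x ∘ h)
    (pt_forget_change_of_base HC f (leg c j))) (Hh j)).
- intros k Hk; apply Uh; intros j.
  exact (eq_trans (f_equal (fun x => x ∘ k)
    (eq_sym (pt_forget_change_of_base HC f (leg c j)))) (Hk j)).
Qed.

Lemma pt_change_of_base_jse (C : Category) (HC : has_finite_limits C)
    (HS : has_finite_coproducts C) (X Y : C) (f : Hom X Y) :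
  preserves_jointly_strongly_epic (slice_change_of_base HC f) ->
  preserves_jointly_strongly_epic (pt_change_of_base HC f).
Proof.
intros Hf A B Z u v Huv.
apply (pt_forget_reflects_jse HS); rewrite !pt_forget_change_of_base.
exact (Hf _ _ _ _ _ (pt_forget_preserves_jse Huv)).
Qed.

Theorem proposition4p1 (C : Category) :
  coherent_category C -> algebraically_coherent C.
Proof.
intros [HR HS HB].
exists (regular_limits HR); intros X Y f.
destruct (HB X Y f) as [HL HJ]; split.
- exact (pt_change_of_base_limits HS HL).
- exact (pt_change_of_base_jse HS HJ).
Qed.
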